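(* Let $\mathcal{H}$ be a finite-dimensional real Hilbert space, $\mathcal{H}\neq\{0\}$, let $\alpha,\beta\in\,]0,\infty[$ and $\rho\in[0,\infty[$ with $\rho\le\alpha^{-1}$, and take $\mu=0$, so that $f\in\mathcal{F}_{\rho,\alpha^{-1}}$ and $g\in\mathcal{F}_{0,\beta^{-1}}$. For the methods GM, FBS1, FBS2 and PRS define $$B_{\mathrm{GM}}(\tau)=\max\{|1-\tau\rho|,\,|1-\tau(\beta^{-1}+\alpha^{-1})|\}\quad\text{for }\tau\in\,]0,\tfrac{2}{\alpha^{-1}+\beta^{-1}}[,$$ $$B_{\mathrm{FBS1}}(\tau)=\max\{|1-\tau\rho|,\,|1-\tau\alpha^{-1}|\}\quad\text{for }\tau\in\,]0,2\alpha[,$$ $$B_{\mathrm{FBS2}}(\tau)=\frac{1}{1+\tau\rho}\quad\text{for }\tau\in\,]0,2\beta],$$ $$B_{\mathrm{PRS}}(\tau)=\max_{a\in\{\rho,\alpha^{-1}\}}\frac{|1-\tau a|}{1+\tau a}\quad\text{for }\tau>0.$$ Then, for each of these four methods $\mathcal{A}\in\{\mathrm{GM},\mathrm{FBS1},\mathrm{FBS2},\mathrm{PRS}\}$ and each admissible step size $\tau$, the value $B_{\mathcal{A}}(\tau)$ is attained by quadratic functions, i.e. there exist quadratic functions $f\in\mathcal{F}_{\rho,\alpha^{-1}}$ and $g\in\mathcal{F}_{0,\beta^{-1}}$ and points $x\neq y$ in $\mathcal{H}$ with $\|\Phi_{f,g}x-\Phi_{f,g}y\|=B_{\mathcal{A}}(\tau)\,\|x-y\|$,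 where $\Phi_{f,g}$ is the iteration of method $\mathcal{A}$ with step size $\tau$; and hence $B_{\mathcal{A}}(\tau)$ is the exact (unimprovable) worst-case contraction factor of the method: $r_{\mathcal{A}}(\tau)=B_{\mathcal{A}}(\tau)$.
   Context: For $0\le m\le L$, $\mathcal{F}_{m,L}$ denotes the class of functions $\mathcal{H}\to\mathbb{R}$ that are $L$-smooth (differentiable with $L$-Lipschitz gradient) and $m$-strongly convex ($0$-strongly convex means convex). For $\tau>0$ and convex $\varphi$, $\mathrm{prox}_{\tau\varphi}(x)=\arg\min_{z\in\mathcal{H}}\ \tau\varphi(z)+\tfrac12\|z-x\|^2$. The methods, for solving $\min_{x\in\mathcal{H}} f(x)+g(x)$, are given by one-iteration maps $\Phi_{f,g}:\mathcal{H}\to\mathcal{H}$ depending on a step size $\tau$: - Gradient method (GM): $\Phi_{f,g}x=x-\tau(\nabla f(x)+\nabla g(x))$. - Forward-backward splitting (FBS1): $\Phi_{f,g}x=\mathrm{prox}_{\tau g}(x-\tau\nabla f(x))$. - Forward-backward splitting (FBS2): $\Phi_{f,g}x=\mathrm{prox}_{\tau f}(x-\tau\nabla g(x))$. - Peaceman-Rachford splitting (PRS): $y=\mathrm{prox}_{\tau f}(x)$, $\Phi_{f,g}x=2\,\mathrm{prox}_{\tau g}(2y-x)-2y+x$. The (exact) worst-case contraction factor $r_{\mathcal{A}}(\tau)$ of a method $\mathcal{A}$ is the smallest $r\ge 0$ such that $\|\Phi_{f,g}x-\Phi_{f,g}y\|\le r\|x-y\|$ for all $f\in\mathcal{F}_{\rho,\alpha^{-1}}$,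 all $g\in\mathcal{F}_{0,\beta^{-1}}$ and all $x,y\in\mathcal{H}$. *)

(* Defs.v *)
From HB Require Import structures.
From mathcomp Require Import all_boot all_order all_algebra.
From mathcomp Require Import all_classical all_reals all_analysis.

Set Implicit Arguments.
Unset Strict Implicit.
Unset Printing Implicit Defensive.

Import Order.TTheory GRing.Theory Num.Theory.
Import numFieldNormedType.Exports.

Local Open Scope classical_set_scope.
Local Open Scope ring_scope.

(* A finite-dimensional real Hilbert space: the normed space carries the
   topology, the vector space structure carries the finite dimension, and the
   norm is the one induced by the inner product. Completeness is automatic in
   finite dimension. *)
HB.mixin Record NormedVector_isHilbert (R : realType) H
    of NormedModule R H & Vector R H := {
  inner : {dot H for idfun} ;
  inner_norm : forall x : H, inner x x = `|x| ^+ 2 }.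

#[short(type="finHilbertType")]
HB.structure Definition FinHilbert (R : realType) :=
  {H of NormedModule R H & Vector R H & NormedVector_isHilbert R H}.

(* The Riesz representative of the differential; it is the gradient only
   where f is differentiable. *)
Definition grad (R : realType) (H : finHilbertType R) (f : H -> R) (x : H) : H :=
  get [set v | forall h, 'd f x h = inner v h].

(* The class F_{m,L}. Strong convexity with modulus m is convexity of
   f - (m/2)|.|^2, which for m = 0 is convexity of f. *)
Definition smooth_strongly_convex (R : realType) (H : finHilbertType R)
    (m L : R) (f : H -> R) : Prop :=
  [/\ forall x, differentiable f x,
      L.-lipschitz (grad f) &
      convex_function setT (fun x : H => f x - m / 2 * `|x| ^+ 2)].

Definition prox (R : realType) (H : finHilbertType R)
    (tau : R) (phi : H -> R) (x : H) : H :=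
  get [set z | forall w, tau * phi z + 2^-1 * `|z - x| ^+ 2
                         <= tau * phi w + 2^-1 * `|w - x| ^+ 2].

(* Degenerate quadratics are included: A may be singular or 0. *)
Definition quadratic (R : realType) (H : finHilbertType R) (f : H -> R) : Prop :=
  exists (A : {linear H -> H}) (b : H) (c : R),
    (forall u v, inner (A u) v = inner u (A v)) /\
    (forall x, f x = 2^-1 * inner (A x) x + inner b x + c).

Inductive splitting_method : Set := GM | FBS1 | FBS2 | PRS.

Definition iteration (R : realType) (H : finHilbertType R)
    (M : splitting_method) (tau : R) (f g : H -> R) (x : H) : H :=
  match M with
  | GM => x - tau *: (grad f x + grad g x)
  | FBS1 => prox tau g (x - tau *: grad f x)
  | FBS2 => prox tau f (x - tau *: grad g x)
  | PRS => let y := prox tau f x in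
           2 *: prox tau g (2 *: y - x) - 2 *: y + x
  end.

Definition admissible_step (R : realType)
    (M : splitting_method) (alpha beta tau : R) : Prop :=
  match M with
  | GM => 0 < tau < 2 / (alpha^-1 + beta^-1)
  | FBS1 => 0 < tau < 2 * alpha
  | FBS2 => 0 < tau <= 2 * beta
  | PRS => 0 < tau
  end.

Definition contraction_bound (R : realType)
    (M : splitting_method) (alpha beta rho tau : R) : R :=
  match M with
  | GM => Num.max `|1 - tau * rho| `|1 - tau * (beta^-1 + alpha^-1)|
  | FBS1 => Num.max `|1 - tau * rho| `|1 - tau * alpha^-1|
  | FBS2 => (1 + tau * rho)^-1
  | PRS => Num.max (`|1 - tau * rho| / (1 + tau * rho))
                   (`|1 - tau * alpha^-1| / (1 + tau * alpha^-1))
  end.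

Definition contraction_factors (R : realType) (H : finHilbertType R)
    (M : splitting_method) (alpha beta rho tau : R) : set R :=
  [set r | 0 <= r /\
    forall f g : H -> R,
      smooth_strongly_convex rho alpha^-1 f ->
      smooth_strongly_convex 0 beta^-1 g ->
      forall x y : H,
        `|iteration M tau f g x - iteration M tau f g y| <= r * `|x - y| ].

(* r is the smallest contraction factor; in particular the minimum exists. *)
Definition is_worst_case_factor (R : realType) (H : finHilbertType R)
    (M : splitting_method) (alpha beta rho tau r : R) : Prop :=
  contraction_factors H M alpha beta rho tau r /\
  lbound (contraction_factors H M alpha beta rho tau) r.

(* Main.v *)
Require Import Defs.
From HB Require Import structures.
From mathcomp Require Import all_boot all_order all_algebra.
From mathcomp Require Import all_classical all_reals all_analysis.
From mathcomp Require Import ring lra.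

Set Implicit Arguments.
Unset Strict Implicit.
Unset Printing Implicit Defensive.

Import Order.TTheory GRing.Theory Num.Theory.
Import numFieldNormedType.Exports.

Local Open Scope classical_set_scope.
Local Open Scope ring_scope.

(**
The whole argument runs through one relation between a displacement d and its
image p, the sector condition <p - m d, L d - p> >= 0: the response p of an
operator behaves as if it were a multiplication of d by a number in [m, L].
Equivalently p lies in the ball of centre (m + L)/2 d and radius
(L - m)/2 |d|.

Upper bounds.  If f is m-strongly convex and L-smooth, then d = x - y and
p = grad f x - grad f y satisfy the (m, L) sector condition ([grad_sector]);
this is the Baillon-Haddad theorem applied to f - (m/2)|.|^2, whose hypotheses
come from a first-order Taylor bound and from convexity.  Sectors add up
([sectorD]), and the optimality condition z + tau grad phi z = x of the
proximal step puts the resolvent in the sector of the inverses 1/(1 + tau L)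
and 1/(1 + tau m) ([prox_sector]).  Finally, by the ball form of the condition
and the triangle inequality, |a d + b p| is at most
max(|a + b m|, |a + b L|) |d| ([sector_affine]).  Taking (a, b) = (1, -tau) on
gradients, (0, 1) on resolvents and (-1, 2) on resolvents gives the exact rate
of a gradient step, of a proximal step and of a reflected proximal step.  The
gradient method is one gradient step on f + g, the two forward-backward methods
are a gradient step followed by a proximal step, and the Peaceman-Rachford
iteration is the composition of the reflected proximal steps of f and of g.

The proximal point exists because closed balls of the finite-dimensional space
are compact, while outside a large enough ball strong convexity of the proximal
objective keeps its values above the value at the centre.

Lower bounds.  On f = (a/2)|.|^2 and g = (b/2)|.|^2 every method acts as the
multiplication by a scalar.  Choosing a among the two extreme curvatures
rho, alpha^-1, and b = 0 (or b = beta^-1 for the gradient method when the upper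
end of the spectrum dominates), makes the modulus of this scalar equal to the
bound.
*)

(** * Inner products and sectors *)

Section InnerProduct.
Context {R : realType} {H : finHilbertType R}.
Implicit Types (u v w d p : H) (a b m L : R).

Lemma innerC u v : inner u v = inner v u.
Proof. by rewrite hermC /= expr0 mul1r. Qed.

Lemma innerDr u v w : inner u (v + w) = inner u v + inner u w.
Proof. exact: linearDr. Qed.

Lemma innerZr u a v : inner u (a *: v) = a * inner u v.
Proof. exact: linearZr_LR. Qed.

Lemma innerNr u v : inner u (- v) = - inner u v.
Proof. by rewrite -scaleN1r innerZr mulN1r. Qed.

Lemma innerDl u v w : inner (v + w) u = inner v u + inner w u.
Proof. by rewrite innerC innerDr !(innerC u). Qed.

Lemma innerZl u a v : inner (a *: v) u = a * inner v u.
Proof. by rewrite innerC innerZr innerC. Qed.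

Lemma innerNl u v : inner (- v) u = - inner v u.
Proof. by rewrite innerC innerNr innerC. Qed.

Lemma inner0r u : inner u 0 = 0.
Proof. by rewrite -(scale0r u) innerZr mul0r. Qed.

Lemma inner_sumr n u (F : 'I_n -> H) :
  inner u (\sum_i F i) = \sum_i inner u (F i).
Proof. by rewrite (big_morph _ (innerDr u) (inner0r u)). Qed.

Definition innerE := (innerDl, innerDr, innerNl, innerNr, innerZl, innerZr).

Lemma inner_ge0 u : 0 <= inner u u.
Proof. by rewrite inner_norm sqr_ge0. Qed.

Lemma inner_inj u v : (forall h, inner u h = inner v h) -> u = v.
Proof.
move=> uv; apply/eqP; rewrite -subr_eq0 -normr_eq0 -sqrf_eq0 -inner_norm.
by rewrite innerDl innerNl uv subrr.
Qed.

Lemma cauchy_schwarz u v : `|inner u v| <= `|u| * `|v|.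
Proof.
rewrite -(@ler_pXn2r _ 2) ?nnegrE ?mulr_ge0// real_normK ?num_real//.
rewrite exprMn -!inner_norm.
have [->|v0] := eqVneq v 0; first by rewrite !inner0r expr0n mulr0.
have vv : 0 < inner v v by rewrite inner_norm exprn_gt0 ?normr_gt0.
rewrite -subr_ge0 -(pmulr_rge0 _ vv).
have := inner_ge0 (inner v v *: u - inner u v *: v).
by rewrite !innerE (innerC v u); congr (0 <= _); ring.
Qed.

Lemma ler_norm_inner a u v : 0 <= a ->
  inner u u <= a ^+ 2 * inner v v -> `|u| <= a * `|v|.
Proof.
move=> a0; rewrite !inner_norm -exprMn.
by rewrite ler_pXn2r ?nnegrE ?mulr_ge0.
Qed.

(** The increments of a symmetric linear map with spectrum in [m, L] satisfy
    this, and it is all that the convergence rates need to know about the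
    operator. *)
Definition sector m L d p := 0 <= inner (p - m *: d) (L *: d - p).

(** The two conditions describe one ball: by polarization <p - m d, L d - p> is
    the squared radius minus the squared distance from p to the centre, for the
    ball with diameter [m d, L d]. *)
Lemma sectorP m L d p : m <= L ->
  sector m L d p <-> `|2 *: p - (m + L) *: d| <= (L - m) * `|d|.
Proof.
rewrite -subr_ge0 => mL; rewrite /sector.
have E : 4 * inner (p - m *: d) (L *: d - p) =
    (L - m) ^+ 2 * inner d d
    - inner (2 *: p - (m + L) *: d) (2 *: p - (m + L) *: d).
  by rewrite !innerE (innerC p d); ring.
rewrite -(@pmulr_rge0 _ 4) // E subr_ge0; split; first exact: ler_norm_inner.
move=> pd; rewrite !inner_norm -exprMn.
by rewrite ler_pXn2r ?nnegrE ?mulr_ge0.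
Qed.

Lemma sectorD m1 L1 m2 L2 d p q : m1 <= L1 -> m2 <= L2 ->
  sector m1 L1 d p -> sector m2 L2 d q -> sector (m1 + m2) (L1 + L2) d (p + q).
Proof.
move=> h1 h2 /(sectorP _ _ h1) s1 /(sectorP _ _ h2) s2.
apply/sectorP; first exact: lerD.
have -> : 2 *: (p + q) - (m1 + m2 + (L1 + L2)) *: d =
    (2 *: p - (m1 + L1) *: d) + (2 *: q - (m2 + L2) *: d).
  by rewrite [RHS]addrACA -opprD -scalerDl -scalerDr; congr (_ - _ *: _); ring.
rewrite (le_trans (ler_normD _ _))//.
have -> : L1 + L2 - (m1 + m2) = (L1 - m1) + (L2 - m2) by ring.
by rewrite mulrDl lerD.
Qed.

(** Inverting x |-> x + tau p exchanges the roles of the two factors: each one is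
    a nonnegative multiple of a factor of the original sector condition. *)
Lemma sector_resolvent m L tau d p : 0 <= m -> m <= L -> 0 <= tau ->
  sector m L d p ->
  sector (1 + tau * L)^-1 (1 + tau * m)^-1 (d + tau *: p) d.
Proof.
move=> m0 mL t0 s.
have L1 : 0 < 1 + tau * L by rewrite ltr_pwDl// mulr_ge0// (le_trans m0).
have m1 : 0 < 1 + tau * m by rewrite ltr_pwDl// mulr_ge0.
have E1 : d - (1 + tau * L)^-1 *: (d + tau *: p) =
    (tau / (1 + tau * L)) *: (L *: d - p).
  apply: (can_inj (scalerK (lt0r_neq0 L1))).
  rewrite scalerBr !scalerA divff ?gt_eqF// scale1r mulrCA divff ?gt_eqF// mulr1.
  by rewrite scalerBr scalerA scalerDl scale1r opprD addrACA subrr add0r.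
have E2 : (1 + tau * m)^-1 *: (d + tau *: p) - d =
    (tau / (1 + tau * m)) *: (p - m *: d).
  apply: (can_inj (scalerK (lt0r_neq0 m1))).
  rewrite scalerBr !scalerA divff ?gt_eqF// scale1r mulrCA divff ?gt_eqF// mulr1.
  by rewrite scalerBr scalerA scalerDl scale1r opprD addrACA subrr add0r.
rewrite /sector E1 E2 innerZl innerZr innerC.
by rewrite !mulr_ge0// invr_ge0 ltW.
Qed.

(** Split p into the centre of its ball and a remainder; the triangle inequality
    gives the factor |a + b (m + L)/2| + |b| (L - m)/2, which is the maximum of
    |a + b t| over [m, L]. *)
Lemma sector_affine m L a b d p : m <= L -> sector m L d p ->
  `|a *: d + b *: p| <= Num.max `|a + b * m| `|a + b * L| * `|d|.
Proof.
move=> mL /(sectorP _ _ mL) s.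
have -> : a *: d + b *: p = (a + b * (m + L) / 2) *: d
    + (b / 2) *: (2 *: p - (m + L) *: d).
  rewrite scalerBr !scalerA [RHS]addrA [RHS]addrAC -scalerBl.
  by congr (_ *: _ + _ *: _); field.
rewrite (le_trans (ler_normD _ _))// (normrZ _ d) (normrZ (b / 2)).
rewrite (@le_trans _ _ ((`|a + b * (m + L) / 2| + `|b / 2| * (L - m)) * `|d|))//.
  by rewrite mulrDl lerD2l -(mulrA `|b / 2|) ler_wpM2l.
rewrite ler_wpM2r// -{1}(@ger0_norm _ (L - m)) ?subr_ge0// -normrM.
rewrite le_max.
set A := a + b * m; set B := a + b * L.
have -> : a + b * (m + L) / 2 = (A + B) / 2 by rewrite /A /B; field.
have -> : b / 2 * (L - m) = (B - A) / 2 by rewrite /A /B; field.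
case: (ger0P ((A + B) / 2)) => ?; case: (ger0P ((B - A) / 2)) => ?;
  case: (ger0P A) => ?; case: (ger0P B) => ?;
  apply/orP; solve [left; lra | right; lra].
Qed.

End InnerProduct.

(** * Gradients and the first-order Taylor bound *)

Section Gradient.
Context {R : realType} {H : finHilbertType R}.
Implicit Types (f : H -> R) (u v w d x y : H) (L m : R).

Import VectorInternalTheory.

(** The map v |-> (<v, e_j>)_j into the coordinate space is injective, hence onto
    by a dimension count; transporting it back to H by the coordinate
    isomorphism makes it an endomorphism. *)
Lemma riesz_representation (l : H -> R) :
  linear l -> exists v, forall h, l h = inner v h.
Proof.
move=> lin_l.
pose e i : H := r2v (delta_mx 0 i).
have expand h : h = \sum_j v2r h 0 j *: e j.
  rewrite -[LHS]v2rK {1}(row_sum_delta (v2r h)) linear_sum.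
  by apply: eq_bigr => j _; rewrite linearZ.
pose T v : H := r2v (\row_j inner v (e j)).
have lin_T : linear T.
  move=> a u v; rewrite /T -linearP; congr r2v.
  by apply/rowP => j; rewrite !mxE innerDl innerZl.
pose TL := GRing.isLinear.Build R H H _ T lin_T.
pose T' : {linear H -> H} := HB.pack T TL.
have ker_T : lker (linfun T') == 0%VS.
  apply/lker0P => u v; rewrite !lfunE /= => /r2v_inj/rowP Tuv.
  apply: inner_inj => h; rewrite (expand h) !inner_sumr.
  apply: eq_bigr => j _; rewrite !innerZr.
  by have := Tuv j; rewrite !mxE => ->.
have := memvf (r2v (\row_j l (e j)) : H).
rewrite -(lker0_limgf ker_T) => /memv_imgP[v _].
rewrite lfunE /= => /r2v_inj/rowP lv; exists v => h.
pose lL := GRing.isLinear.Build R H R _ l lin_l.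
pose l' : {linear H -> R} := HB.pack l lL.
rewrite -[LHS]/(l' h) (expand h) inner_sumr linear_sum.
apply: eq_bigr => j _; rewrite innerZr linearZ /=.
by have := lv j; rewrite !mxE => ->.
Qed.

Lemma gradP f x h : 'd f x h = inner (grad f x) h.
Proof.
have [v vP] := @riesz_representation ('d f x) (linearP _).
by have := @getPex _ [set v | forall h, 'd f x h = inner v h]
  (ex_intro _ v vP); exact.
Qed.

Lemma grad_eq f x v : (forall h, 'd f x h = inner v h) -> grad f x = v.
Proof. by move=> fv; apply: inner_inj => h; rewrite -gradP. Qed.

Lemma lipschitz_grad f L x y : L.-lipschitz (grad f) ->
  `|grad f x - grad f y| <= L * `|x - y|.
Proof. by move=> /(_ (x, y)); exact. Qed.

Lemma is_derive_line f x d (t : R) : differentiable f (x + t *: d) ->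
  is_derive t 1 (fun s : R => f (x + s *: d)) (inner (grad f (x + t *: d)) d).
Proof.
move=> df.
pose D : R -> H := fun s => s *: d.
have dg : is_diff t (fun s : R => x + s *: d) D.
  have := @is_diffD _ _ _ (cst x) D 0 D t _ _.
  by rewrite add0r; exact.
have df' : is_diff (x + t *: d) f ('d f (x + t *: d)) by exact: DiffDef.
have [ex_fg fgE] := @is_diff_comp _ _ _ _ _ _ _ _ _ dg df'.
apply: DeriveDef; first exact/diff_derivable.
by rewrite (deriveE _ ex_fg) fgE /= /D scale1r gradP.
Qed.

(** Both inequalities follow from the same monotonicity argument, for e = 1 and
    e = -1: the function phi below has a nonpositive derivative because the
    gradient varies by at most L s |d| along the segment. *)
Lemma lipschitz_taylor f L x y :
  (forall z, differentiable f z) -> L.-lipschitz (grad f) ->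
  `|f y - f x - inner (grad f x) (y - x)| <= L / 2 * `|y - x| ^+ 2.
Proof.
move=> df lipf; set d := y - x; set c := inner _ d.
have bound e : `|e| = 1 -> e * (f y - f x - c) <= L / 2 * `|d| ^+ 2.
  move=> e1.
  pose phi (s : R) := e * (f (x + s *: d) - s * c) - L / 2 * `|d| ^+ 2 * s ^+ 2.
  pose phi' (s : R) := e * (inner (grad f (x + s *: d)) d - c) - L * `|d| ^+ 2 * s.
  have dphi (s : R) : is_derive s 1 phi (phi' s).
    pose F (s : R) := f (x + s *: d).
    have fl : is_derive s 1 F _ := is_derive_line (df (x + s *: d)).
    have -> : phi = e *: (F - c *: id) - (L / 2 * `|d| ^+ 2) *: (id ^+ 2).
      by apply/funext => r; rewrite /phi (mulrC r c).
    apply: is_derive_eq.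
    rewrite -[LHS]/(e * (inner (grad f (x + s *: d)) d - c * 1)
                    - L / 2 * `|d| ^+ 2 * (2 * s ^+ 1 * 1)) /phi'.
    by move: (inner _ _) (c) (`|d| ^+ 2) => i c' n; field.
  have phi'_le0 s : s \in `]0, 1[%R -> phi' s <= 0.
    rewrite in_itv /= => /andP[s0 _]; rewrite /phi' /c subr_le0.
    rewrite -(innerNl d) -innerDl (le_trans (ler_norm _))// normrM e1 mul1r.
    rewrite (le_trans (cauchy_schwarz _ _))//.
    have := lipschitz_grad (x + s *: d) x lipf.
    rewrite (addrC x) addrK normrZ (gtr0_norm s0) => le_s.
    rewrite (le_trans (ler_wpM2r (normr_ge0 d) le_s))//.
    by rewrite expr2 le_eqVlt; apply/orP; left; apply/eqP; ring.
  have dphi1 s : derivable phi s 1 by have [] := dphi s.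
  have phi1 : phi 1 <= phi 0.
    apply: (@ler0_derive1_le_cc _ phi 0 1) => //.
    - by move=> s /phi'_le0; rewrite derive1E derive_val.
    - by apply: derivable_within_continuous.
    - by rewrite in_itv /= lexx ler01.
    - by rewrite in_itv /= lexx ler01.
  move: phi1; rewrite /phi scale1r scale0r addr0 (addrC x) subrK.
  by rewrite expr0n expr1n /= mulr0 mul0r !mulr1 mul1r subr0; lra.
rewrite ler_norml -lerN2 opprK.
have := bound 1; have := bound (-1); rewrite normrN normr1 mulN1r mul1r.
by move=> /(_ erefl) -> /(_ erefl) ->.
Qed.
End Gradient.

(** * Cocoercivity of gradients *)

Section Cocoercivity.
Context {R : realType} {H : finHilbertType R}.
Implicit Types (f h : H -> R) (x y : H) (L m : R).

Lemma le0_of_small_multiples (a b : R) :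
  (forall t, 0 < t <= 1 -> a <= t * b) -> a <= 0.
Proof.
move=> ab; rewrite leNgt; apply/negP => a0.
have c0 : 0 < a + `|b| by rewrite ltr_pwDl.
have /ab : 0 < a / (a + `|b|) <= 1.
  by rewrite divr_gt0//= ler_pdivrMr// mul1r lerDl.
apply/negP; rewrite -ltNge mulrAC ltr_pdivrMr// ltr_pM2l//.
by rewrite (le_lt_trans (ler_norm b))// ltrDr.
Qed.

Lemma convex_on_segment h x y (t : R) : convex_function setT h ->
  0 <= t <= 1 -> h (x + t *: (y - x)) <= t * h y + (1 - t) * h x.
Proof.
move=> cvx_h /andP[t0 t1].
have := cvx_h (Itv01 t0 t1) y x; rewrite !inE => /(_ I I).
congr (h _ <= _); rewrite /conv /=.
by rewrite scalerBr addrCA scalerBl scale1r.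
Qed.

(** Convexity bounds f on the segment from above, the Taylor bound from below by
    the tangent up to an error of order t^2; comparing the terms of order t gives
    the tangent inequality without computing any limit. *)
Lemma strongly_convex_lower m L f x y : smooth_strongly_convex m L f ->
  f x + inner (grad f x) (y - x) + m / 2 * `|y - x| ^+ 2 <= f y.
Proof.
move=> [df lipf cvx]; set d := y - x; set c := inner _ d.
rewrite -subr_le0.
apply: (@le0_of_small_multiples _ ((L + m) / 2 * `|d| ^+ 2)) => t /andP[t0 t1].
have t01 : 0 <= t <= 1 by rewrite ltW.
have seg := convex_on_segment x y cvx t01.
have := lipschitz_taylor x (x + t *: d) df lipf.
rewrite ler_norml => /andP[taylor _]; move: taylor.
rewrite {1 3}(addrC x) addrK innerZr -/c normrZ exprMn (gtr0_norm t0) => taylor.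
rewrite -(ler_pM2l t0).
have normE : `|x + t *: d| ^+ 2 = t * `|y| ^+ 2 + (1 - t) * `|x| ^+ 2
    - t * (1 - t) * `|d| ^+ 2.
  by rewrite -!inner_norm /d !innerE (innerC y x); ring.
move: seg taylor; rewrite -/d normE; set F := f (_ + _).
move: (`|x| ^+ 2) (`|y| ^+ 2) (`|d| ^+ 2) (f x) (f y) (c) F.
by move=> X Y D fx fy c' F; lra.
Qed.

(** Test the tangent inequality at one point against the quadratic upper bound at
    the other, on the gradient step y + t q, and symmetrically on x - t q.  The
    sum reads (2 t - K t^2) |q|^2 <= <q, x - y> for every t; the best t is 1/K.
    For K = 0 the left side is unbounded in t, which forces q = 0. *)
Lemma baillon_haddad (K : R) h (G : H -> H) : 0 <= K ->
  (forall x y, h x + inner (G x) (y - x) <= h y) ->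
  (forall x y, h y <= h x + inner (G x) (y - x) + K / 2 * `|y - x| ^+ 2) ->
  forall x y, sector 0 K (x - y) (G x - G y).
Proof.
move=> K0 lower upper x y; rewrite /sector scale0r subr0.
move gradB : (G x - G y) => q.
have step (t : R) : (2 * t - K * t ^+ 2) * inner q q <= inner q (x - y).
  have yz : y + t *: q - y = t *: q by rewrite (addrC y) addrK.
  have xz : x - t *: q - x = - (t *: q) by rewrite addrAC subrr add0r.
  have := le_trans (lower x (y + t *: q)) (upper y (y + t *: q)).
  have := le_trans (lower y (x - t *: q)) (upper x (x - t *: q)).
  rewrite yz xz -!inner_norm !innerE.
  have qE v : inner q v = inner (G x) v - inner (G y) v.
    by rewrite -gradB innerDl innerNl.
  rewrite !qE.
  move: (inner (G x) x) (inner (G x) y) (inner (G y) x) (inner (G y) y).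
  move: (inner (G x) q) (inner (G y) q) (h x) (h y).
  by move=> a b hx hy a1 a2 b1 b2 le1 le2; lra.
have [Kpos|] := ltrP 0 K.
  have := step K^-1; rewrite -(ler_pM2l Kpos) -subr_ge0 => s.
  rewrite innerDr innerZr innerNr.
  suff <- : K * ((2 * K^-1 - K * K^-1 ^+ 2) * inner q q) = inner q q by [].
  by field; exact: lt0r_neq0.
move=> K_le0; have {K_le0} K_0 : K = 0 by apply/le_anti/andP.
rewrite K_0 in step *.
have [->|q0] := eqVneq q 0; first by rewrite innerC inner0r.
have Q0 : 0 < inner q q by rewrite inner_norm exprn_gt0 ?normr_gt0.
(* this t makes the left side of step equal to <q, x - y> + 1 *)
have := step ((inner q (x - y) + 1) / (2 * inner q q)).
rewrite mul0r subr0 mulrA [X in X <= _](_ : _ = inner q (x - y) + 1).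
  by rewrite gerDl ler10.
by field; exact: lt0r_neq0.
Qed.

(** Subtracting (m/2)|.|^2 turns f into a convex function with a quadratic upper
    bound of curvature L - m, and shifts the sector (m, L) to (0, L - m). *)
Lemma grad_sector m L f x y : m <= L -> smooth_strongly_convex m L f ->
  sector m L (x - y) (grad f x - grad f y).
Proof.
rewrite -subr_ge0 => mL f_mL; have [df lipf _] := f_mL.
pose h z := f z - m / 2 * inner z z; pose G z := grad f z - m *: z.
have lower z w : h z + inner (G z) (w - z) <= h w.
  have := strongly_convex_lower z w f_mL.
  rewrite /h /G -inner_norm !innerE (innerC w z).
  move: (inner (grad f z) w) (inner (grad f z) z) (inner z w) (inner z z).
  by move: (inner w w) (f z) (f w) => a b c d e k l; lra.
have upper z w :
    h w <= h z + inner (G z) (w - z) + (L - m) / 2 * `|w - z| ^+ 2.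
  have := lipschitz_taylor z w df lipf; rewrite ler_norml => /andP[_].
  rewrite /h /G -!inner_norm !innerE (innerC w z).
  move: (inner (grad f z) w) (inner (grad f z) z) (inner z w) (inner z z).
  by move: (inner w w) (f z) (f w) => a b c d e k l; lra.
have := baillon_haddad mL lower upper x y.
have GB : G x - G y = (grad f x - grad f y) - m *: (x - y).
  by rewrite /G scalerBr opprD addrACA -opprD.
rewrite /sector scale0r subr0 GB; congr (0 <= inner _ _).
by rewrite scalerBl opprB addrA subrK.
Qed.

End Cocoercivity.

(** * Proximal points *)

Section Prox.
Context {R : realType} {H : finHilbertType R}.
Implicit Types (phi : H -> R) (x y : H) (L m tau : R).

Import VectorInternalTheory.

Lemma r2v_continuous : continuous (r2v : 'rV[R]_(dim H) -> H).
Proof.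
have r2vE (b : 'rV[R]_(dim H)) :
    r2v b = \sum_j b 0 j *: (r2v (delta_mx 0 j) : H).
  rewrite {1}(row_sum_delta b) linear_sum.
  by apply: eq_bigr => j _; rewrite linearZ.
rewrite (funext r2vE).
apply: continuous_big => [|j _ a]; first exact: add_continuous.
apply: (cvgZr_tmp (F := nbhs a)); exact: coord_continuous.
Qed.

(** Coordinates are represented by inner products, so by Cauchy-Schwarz they are
    bounded on the ball; the ball is then a closed subset of the continuous image
    of a compact box. *)
Lemma compact_hilbert_ball x (r : R) : compact (closed_ball_ Num.norm x r).
Proof.
have coordP j : exists v, forall w : H, v2r w 0 j = inner v w.
  apply: riesz_representation => a u v.
  by rewrite linearP !mxE.
have [v vP] := choice coordP.
pose M j := `|v j| * (`|x| + r).
pose box := [set a : 'rV[R]_(dim H) |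
  forall j, `[- M j, M j]%classic (a ord0 j)].
have box_compact : compact box.
  apply: (@rV_compact _ _ (fun j => `[- M j, M j]%classic)) => j.
  exact: segment_compact.
apply: (@subclosed_compact _ _ (r2v @` box)).
- exact: closed_closed_ball_.
- apply: continuous_compact => //.
  by apply: continuous_subspaceT; exact: r2v_continuous.
- move=> w; rewrite /closed_ball_ /= => xw; exists (v2r w); last exact: v2rK.
  move=> j /=; rewrite in_itv /= -ler_norml vP (le_trans (cauchy_schwarz _ _))//.
  rewrite ler_wpM2l// -[w](subKr x) (le_trans (ler_normB _ _))//.
  by rewrite lerD2l.
Qed.

Lemma grad_lower m L phi x y : 0 <= m -> smooth_strongly_convex m L phi ->
  phi x + inner (grad phi x) (y - x) <= phi y.
Proof.
move=> m0 phi_mL; apply: le_trans (strongly_convex_lower x y phi_mL).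
by rewrite lerDl mulr_ge0 ?divr_ge0 ?exprn_ge0.
Qed.

(** By the tangent inequality at x, the proximal objective at w is at least its
    value at x as soon as |w - x| >= 2 tau |grad phi x|; so a minimizer over the ball
    of that radius is global. *)
Lemma prox_exists m L phi tau x :
    0 <= m -> 0 <= tau -> smooth_strongly_convex m L phi ->
  exists z, forall w, tau * phi z + 2^-1 * `|z - x| ^+ 2
                      <= tau * phi w + 2^-1 * `|w - x| ^+ 2.
Proof.
move=> m0 tau0 phi_cvx; have [dphi _ _] := phi_cvx.
pose F w := tau * phi w + 2^-1 * `|w - x| ^+ 2.
pose r := 2 * tau * `|grad phi x|.
have r0 : 0 <= r by rewrite !mulr_ge0.
have x_in : closed_ball_ Num.norm x r x by rewrite /closed_ball_ /= subrr normr0.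
have F_cont : continuous F.
  move=> w; apply: cvgD; apply: cvgMl_tmp.
    exact/differentiable_continuous.
  have n_cont : `|v - x| @[v --> w] --> `|w - x|.
    by apply: cvg_norm; apply: cvgB; [exact: cvg_id|exact: cvg_cst].
  exact: cvgM.
have [z z_in z_min] := compact_EVT_min (ex_intro _ x x_in)
  (compact_hilbert_ball (x := x) (r := r)) (continuous_subspaceT F_cont).
exists z => w; rewrite -/(F z) -/(F w).
have [w_in|w_out] := lerP `|x - w| r; first by apply: z_min; rewrite inE.
have Fzx : F z <= F x by apply: z_min; rewrite inE.
apply: (le_trans Fzx); rewrite /F subrr normr0 expr0n mulr0 addr0.
have := grad_lower x w m0 phi_cvx.
have := cauchy_schwarz (grad phi x) (w - x).
rewrite ler_norml => /andP[cs _].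
move: w_out; rewrite distrC /r => w_out lower.
have : 0 <= tau * (phi w - phi x + `|grad phi x| * `|w - x|).
  by rewrite mulr_ge0//; lra.
have := normr_ge0 (w - x).
move: w_out; move: `|w - x| `|grad phi x| => n g *; nra.
Qed.

(** At a minimizer the gradient g of the proximal objective vanishes, since a
    gradient step of length k = 1/(tau L + 1), the inverse of its smoothness
    constant, would decrease the objective by k |g|^2 / 2. *)
Lemma prox_optimality m L phi tau x :
    0 <= m -> 0 <= L -> 0 <= tau -> smooth_strongly_convex m L phi ->
  prox tau phi x + tau *: grad phi (prox tau phi x) = x.
Proof.
move=> m0 L0 tau0 phi_cvx; have [dphi lipphi _] := phi_cvx.
have /= := @getPex _ [set z | forall w, tau * phi z + 2^-1 * `|z - x| ^+ 2
                         <= tau * phi w + 2^-1 * `|w - x| ^+ 2]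
  (prox_exists x m0 tau0 phi_cvx).
rewrite -/(prox tau phi x); set p := prox tau phi x => p_min.
move gE : (p + tau *: grad phi p - x) => g.
suff g0 : g = 0 by apply/eqP; rewrite -subr_eq0 gE g0.
have K0 : 0 < tau * L + 1 by rewrite ltr_wpDl// mulr_ge0.
have [k kE] : exists k, k = (tau * L + 1)^-1 by exists (tau * L + 1)^-1.
have k0 : 0 < k by rewrite kE invr_gt0.
have kK : (tau * L + 1) * k = 1 by rewrite kE divff ?lt0r_neq0.
apply/eqP; rewrite -normr_eq0 -sqrf_eq0 -inner_norm eq_le inner_ge0 andbT.
rewrite -(pmulr_rle0 _ k0).
have step : p - k *: g - p = - (k *: g) by rewrite addrAC subrr add0r.
have shift : p - k *: g - x = (p - x) - k *: g by rewrite addrAC.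
have := lipschitz_taylor p (p - k *: g) dphi lipphi.
have := p_min (p - k *: g).
have gradE : tau * inner (grad phi p) g = inner g g - inner (p - x) g.
  by rewrite -[X in inner X _ - _]gE !innerE; ring.
rewrite ler_norml step shift => min /andP[_ upper].
have := ler_wpM2l tau0 upper; move: min.
have kQ : (tau * L + 1) * k * (k * inner g g) = k * inner g g.
  by rewrite kK mul1r.
rewrite -!inner_norm !innerE (innerC g x) (innerC g p).
move: gradE kQ; rewrite !innerE.
move: (inner g g) (inner p g) (inner x g) (inner (grad phi p) g).
move: (inner p p) (inner p x) (inner x p) (inner x x) (phi (_ - _)) (phi p).
move=> pp px xp xx fv fp Q pg xg dg /(congr1 ( *%R k)) gradE kQ min_p descent.
lra.
Qed.

Lemma prox_sector m L phi tau x y : 0 <= m -> m <= L -> 0 <= tau ->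
    smooth_strongly_convex m L phi ->
  sector (1 + tau * L)^-1 (1 + tau * m)^-1
    (x - y) (prox tau phi x - prox tau phi y).
Proof.
move=> m0 mL tau0 phi_mL; have L0 : 0 <= L := le_trans m0 mL.
have := grad_sector (prox tau phi x) (prox tau phi y) mL phi_mL.
move=> /(sector_resolvent m0 mL tau0).
rewrite scalerBr addrACA -opprD.
by rewrite !(prox_optimality _ m0 L0 tau0 phi_mL).
Qed.

End Prox.

(** * Isotropic quadratics *)

Section IsotropicQuadratic.
Context {R : realType} {H : finHilbertType R}.
Implicit Types (x y u : H) (a m L tau : R).

Definition isotropic a x : R := a / 2 * inner x x.

(** Polarization reduces this to the continuity of the norm. *)
Lemma inner_continuous u : continuous (inner u : H -> R).
Proof.
have innerE2 v : inner u v = 2^-1 * (`|u + v| ^+ 2 - `|u| ^+ 2 - `|v| ^+ 2).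
  by rewrite -!inner_norm !innerE (innerC v u); field.
rewrite (funext innerE2) => v; apply: cvgMl_tmp; apply: cvgB; first apply: cvgB.
- have c : `|u + w| @[w --> v] --> `|u + v|.
    by apply: cvg_norm; apply: cvgD; [exact: cvg_cst|exact: cvg_id].
  exact: cvgM.
- exact: cvg_cst.
- have c : `|w| @[w --> v] --> `|v| by apply: cvg_norm; exact: cvg_id.
  exact: cvgM.
Qed.

Lemma quadratic_isotropic a : quadratic (isotropic a : H -> R).
Proof.
exists (a \*: idfun), 0, 0; split=> [u v|x] /=.
  by rewrite innerZl innerZr.
by rewrite innerC innerZr (innerC 0) inner0r /isotropic !addr0; ring.
Qed.

Lemma diff_isotropic a x :
  differentiable (isotropic a) x /\ grad (isotropic a) x = a *: x.
Proof.
have lin : linear (inner (a *: x) : H -> R).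
  by move=> k u v; rewrite innerDr innerZr.
pose dM := GRing.isLinear.Build _ _ _ _ _ lin.
pose d : {linear H -> R} := HB.pack (inner (a *: x) : H -> R) dM.
have d_cont : continuous d by exact: inner_continuous.
have expansion : isotropic a \o shift x =
    cst (isotropic a x) + (d : H -> R) +o_ 0 id.
  apply/eqaddoP => e e0.
  have a1 : 0 < `|a / 2| + 1 by rewrite ltr_wpDl.
  near=> h.
  rewrite !fctE /= /isotropic.
  have -> : a / 2 * inner (h + x) (h + x)
      - (a / 2 * inner x x + inner (a *: x) h) = a / 2 * `|h| ^+ 2.
    by rewrite -inner_norm !innerE (innerC h x); field.
  rewrite normrM normrX normr_id expr2 mulrA ler_wpM2r//.
  have h_small : `|h| <= e / (`|a / 2| + 1).
    near: h; exact: (@nbhs0_le _ H _ (divr_gt0 e0 a1)).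
  rewrite (le_trans (ler_wpM2l (normr_ge0 _) h_small))//.
  by rewrite mulrCA ger_pMr// ler_pdivrMr// mul1r lerDl.
split; first by apply/diff_locallyP; rewrite (diff_unique d_cont expansion).
apply: grad_eq => h.
by rewrite (diff_unique d_cont expansion).
Unshelve. all: by end_near. Qed.

Lemma isotropic_smooth_strongly_convex m L a : 0 <= a -> m <= a -> a <= L ->
  smooth_strongly_convex m L (isotropic a : H -> R).
Proof.
move=> a0 ma aL.
have segment (s : R) x y (z := s *: x + (1 - s) *: y) : 0 <= s -> s <= 1 ->
    a / 2 * inner z z - m / 2 * `|z| ^+ 2 <=
    s * (a / 2 * inner x x - m / 2 * `|x| ^+ 2)
    + (1 - s) * (a / 2 * inner y y - m / 2 * `|y| ^+ 2).
  move=> s0 s1; rewrite -subr_ge0.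
  have : 0 <= (a - m) / 2 * (s * (1 - s)) * inner (x - y) (x - y).
    rewrite mulr_ge0 ?inner_ge0// mulr_ge0 ?divr_ge0 ?subr_ge0//.
    by rewrite mulr_ge0 ?subr_ge0.
  congr (0 <= _).
  by rewrite /z -!inner_norm !innerE (innerC y x); field.
split.
- by move=> x; have [] := diff_isotropic a x.
- move=> [x y] _ /=.
  rewrite (diff_isotropic a x).2 (diff_isotropic a y).2 -scalerBr normrZ.
  by rewrite ger0_norm// ler_wpM2r.
- move=> t x y _ _; have t0 : 0 <= t%:num by [].
  have t1 : t%:num <= 1 by [].
  rewrite convRE /isotropic /conv /= /unstable.onem.
  exact: (segment (t%:num) x y t0 t1).
Qed.

Lemma prox_isotropic a tau x : 0 <= a -> 0 <= tau ->
  prox tau (isotropic a) x = (1 + tau * a)^-1 *: x.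
Proof.
move=> a0 tau0.
have := prox_optimality x (lexx 0) a0 tau0
  (isotropic_smooth_strongly_convex a0 a0 (lexx a)).
set p := prox _ _ _; rewrite (diff_isotropic a p).2 scalerA.
rewrite -{1}(scale1r p) -scalerDl => <-.
by rewrite scalerK// lt0r_neq0// ltr_pwDl// mulr_ge0.
Qed.

End IsotropicQuadratic.

(** * Exact rates of the elementary steps *)

Section StepContractions.
Context {R : realType} {H : finHilbertType R}.
Implicit Types (h : H -> R) (x y : H) (m L tau : R).

Lemma gradient_step_contraction m L tau h x y :
    m <= L -> smooth_strongly_convex m L h ->
  `|(x - tau *: grad h x) - (y - tau *: grad h y)|
    <= Num.max `|1 - tau * m| `|1 - tau * L| * `|x - y|.
Proof.
move=> mL /(grad_sector x y mL) /(sector_affine 1 (- tau) mL).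
by rewrite scale1r scalerBr !scaleNr !mulNr opprD addrACA.
Qed.

Lemma resolvent_rates_le m L tau : 0 <= m -> m <= L -> 0 <= tau ->
  0 < 1 + tau * m <= 1 + tau * L.
Proof.
move=> m0 mL tau0.
by rewrite ltr_pwDl ?mulr_ge0//= lerD2l ler_wpM2l.
Qed.

Lemma prox_contraction m L tau h x y :
    0 <= m -> m <= L -> 0 <= tau -> smooth_strongly_convex m L h ->
  `|prox tau h x - prox tau h y| <= (1 + tau * m)^-1 * `|x - y|.
Proof.
move=> m0 mL tau0 /(prox_sector x y m0 mL tau0).
have /andP[m1 m1L] := resolvent_rates_le m0 mL tau0.
have rates : (1 + tau * L)^-1 <= (1 + tau * m)^-1.
  by rewrite lef_pV2 ?posrE// (lt_le_trans m1).
move=> /(sector_affine 0 1 rates).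
rewrite scale0r scale1r !add0r !mul1r.
rewrite !ger0_norm ?invr_ge0 ?(ltW m1) ?(le_trans (ltW m1))//.
by rewrite (max_idPr rates).
Qed.

(** The Cayley transform t |-> 2/(1 + tau t) - 1 = (1 - tau t)/(1 + tau t) of the
    two end points gives the two terms of the maximum. *)
Lemma reflected_prox_contraction m L tau h x y :
    0 <= m -> m <= L -> 0 <= tau -> smooth_strongly_convex m L h ->
  `|(2 *: prox tau h x - x) - (2 *: prox tau h y - y)|
    <= Num.max (`|1 - tau * m| / (1 + tau * m))
               (`|1 - tau * L| / (1 + tau * L)) * `|x - y|.
Proof.
move=> m0 mL tau0 /(prox_sector x y m0 mL tau0).
have /andP[m1 m1L] := resolvent_rates_le m0 mL tau0.
have L1 := lt_le_trans m1 m1L.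
have rates : (1 + tau * L)^-1 <= (1 + tau * m)^-1 by rewrite lef_pV2 ?posrE.
move=> /(sector_affine (-1) 2 rates).
have cayley a : 0 < 1 + tau * a ->
    `|-1 + 2 * (1 + tau * a)^-1| = `|1 - tau * a| / (1 + tau * a).
  move=> a1; rewrite -[in RHS](gtr0_norm a1) -normf_div; congr `|_|.
  by field; exact: lt0r_neq0.
rewrite !cayley// maxC scaleN1r scalerBr.
by congr (`|_| <= _); rewrite addrC opprD addrACA -opprD.
Qed.

End StepContractions.

(** * The four methods *)

Section Contraction.
Context {R : realType} {H : finHilbertType R}.
Context (alpha beta rho : R) (alpha_gt0 : 0 < alpha) (beta_gt0 : 0 < beta).
Context (rho_ge0 : 0 <= rho) (rho_le : rho <= alpha^-1).

Let ia_ge0 : 0 <= alpha^-1. Proof. by rewrite invr_ge0 ltW. Qed.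
Let ib_ge0 : 0 <= beta^-1. Proof. by rewrite invr_ge0 ltW. Qed.

Lemma admissible_step_gt0 M tau :
  admissible_step M alpha beta tau -> 0 < tau.
Proof. by case: M => //= /andP[]. Qed.

Lemma contraction_bound_ge0 M tau : 0 <= tau ->
  0 <= contraction_bound M alpha beta rho tau.
Proof.
by case: M => tau0 /=; rewrite ?le_max ?normr_ge0// ?invr_ge0 ?divr_ge0//
  addr_ge0// mulr_ge0.
Qed.

(** The steps of g alone are nonexpansive, since its lower curvature is 0; for the
    gradient step in FBS2 this is where tau <= 2 beta enters.  Hence the rate of
    each composed method is the rate of its step of f. *)
Lemma iteration_contraction M tau f g (x y : H) :
    admissible_step M alpha beta tau ->
    smooth_strongly_convex rho alpha^-1 f ->
    smooth_strongly_convex 0 beta^-1 g ->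
  `|iteration M tau f g x - iteration M tau f g y|
    <= contraction_bound M alpha beta rho tau * `|x - y|.
Proof.
move=> adm cf cg; have tau0 := admissible_step_gt0 adm.
have tau_ge0 := ltW tau0.
case: M adm => /= [_|_|/andP[_ tau_le]|_].
- have := sectorD rho_le ib_ge0 (grad_sector x y rho_le cf)
    (grad_sector x y ib_ge0 cg).
  have sum_le : rho + 0 <= alpha^-1 + beta^-1 by exact: lerD.
  move=> /(sector_affine 1 (- tau) sum_le).
  rewrite addr0 (addrC alpha^-1) !mulNr; congr (`|_| <= _).
  rewrite scale1r scaleNr opprD [RHS]addrACA -opprD -scalerBr.
  by congr (_ - _ *: _); rewrite opprD addrACA.
- have := prox_contraction (x - tau *: grad f x) (y - tau *: grad f y)
    (lexx 0) ib_ge0 tau_ge0 cg.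
  rewrite mulr0 addr0 invr1 mul1r => /le_trans; apply.
  exact: gradient_step_contraction.
- have := prox_contraction (x - tau *: grad g x) (y - tau *: grad g y)
    rho_ge0 rho_le tau_ge0 cf.
  move=> /le_trans; apply; rewrite ler_wpM2l ?invr_ge0 ?addr_ge0 ?mulr_ge0//.
  have := gradient_step_contraction tau x y ib_ge0 cg.
  move=> /le_trans; apply; rewrite ler_piMl// ge_max mulr0 subr0 normr1 lexx /=.
  have : tau * beta^-1 <= 2 by rewrite ler_pdivrMr.
  have : 0 <= tau * beta^-1 by rewrite mulr_ge0.
  by rewrite ler_norml => *; apply/andP; split; lra.
(* with u = 2 y - x, the iteration is the reflected proximal step of g at u *)
- set u := 2 *: prox tau f x - x; set v := 2 *: prox tau f y - y.
  have -> : 2 *: prox tau g u - 2 *: prox tau f x + x = 2 *: prox tau g u - u.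
    by rewrite /u opprB addrAC addrA.
  have -> : 2 *: prox tau g v - 2 *: prox tau f y + y = 2 *: prox tau g v - v.
    by rewrite /v opprB addrAC addrA.
  have := reflected_prox_contraction u v (lexx 0) ib_ge0 tau_ge0 cg.
  move=> /le_trans; apply.
  have uv := reflected_prox_contraction x y rho_ge0 rho_le tau_ge0 cf.
  apply: le_trans uv; rewrite ler_piMl// ge_max mulr0 subr0 addr0 normr1 divr1.
  rewrite lexx /=.
  have tb : 0 <= tau * beta^-1 by rewrite mulr_ge0.
  rewrite ler_pdivrMr ?mul1r ?ltr_pwDl// ler_norml.
  by apply/andP; split; lra.
Qed.

(** When g = 0, its proximal map is the identity and its reflected proximal map
    too, so only the step of f remains, and it multiplies by a function of the
    curvature a; the larger term of the bound tells which a to take.  For the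
    gradient method only the sum of the curvatures matters, and its upper end
    calls for b = beta^-1. *)
Lemma bound_attained M tau : admissible_step M alpha beta tau ->
  exists a b c : R,
    [/\ rho <= a <= alpha^-1, 0 <= b <= beta^-1,
        forall x : H, iteration M tau (isotropic a) (isotropic b) x = c *: x &
        `|c| = contraction_bound M alpha beta rho tau].
Proof.
move=> adm; have tau0 := admissible_step_gt0 adm.
have prox0 z : prox tau (isotropic 0) z = z :> H.
  by rewrite prox_isotropic ?(ltW tau0)// mulr0 addr0 invr1 scale1r.
case: M adm => /= _.
- have iterE a b (x : H) :
      x - tau *: (grad (isotropic a) x + grad (isotropic b) x)
      = (1 - tau * (b + a)) *: x.
    rewrite !(diff_isotropic _ x).2 -scalerDl scalerA (addrC a).
    by rewrite scalerBl scale1r.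
  rewrite /Num.max; case: ifP => _.
    exists alpha^-1, beta^-1, (1 - tau * (beta^-1 + alpha^-1)).
    by rewrite rho_le ib_ge0 !lexx; split.
  exists rho, 0, (1 - tau * rho); rewrite rho_le ib_ge0 !lexx; split=> // x.
  by rewrite iterE add0r.
- have iterE a (x : H) :
      prox tau (isotropic 0) (x - tau *: grad (isotropic a) x)
      = (1 - tau * a) *: x.
    by rewrite prox0 (diff_isotropic _ x).2 scalerBl scale1r -scalerA.
  rewrite /Num.max; case: ifP => _.
    by exists alpha^-1, 0, (1 - tau * alpha^-1); rewrite rho_le ib_ge0 !lexx.
  by exists rho, 0, (1 - tau * rho); rewrite rho_le ib_ge0 !lexx.
- exists rho, 0, (1 + tau * rho)^-1; rewrite rho_le ib_ge0 !lexx; split=> //.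
    move=> x; rewrite (diff_isotropic _ x).2 scale0r scaler0 subr0.
    by rewrite prox_isotropic// ltW.
  by rewrite ger0_norm// invr_ge0 addr_ge0// mulr_ge0// ltW.
- have one_plus_gt0 a : 0 <= a -> 0 < 1 + tau * a.
    by move=> a0; rewrite ltr_pwDl// mulr_ge0// ltW.
  have iterE a (x : H) : 0 <= a ->
      iteration PRS tau (isotropic a) (isotropic 0) x =
      ((1 - tau * a) / (1 + tau * a)) *: x.
    move=> a0 /=; rewrite prox0 prox_isotropic// ?ltW// scalerA.
    rewrite -addrA (addrC (- _)) -[x - _]opprB scaler_nat mulr2n addrK.
    rewrite -{2}(scale1r x) -scalerBl; congr (_ *: _).
    by field; rewrite lt0r_neq0// one_plus_gt0.
  have normE a : 0 <= a ->
      `|(1 - tau * a) / (1 + tau * a)| = `|1 - tau * a| / (1 + tau * a).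
    by move=> a0; rewrite normf_div (gtr0_norm (one_plus_gt0 a a0)).
  rewrite /Num.max; case: ifP => _.
    exists alpha^-1, 0, ((1 - tau * alpha^-1) / (1 + tau * alpha^-1)).
    by rewrite rho_le ib_ge0 !lexx normE//; split=> // x; exact: iterE.
  exists rho, 0, ((1 - tau * rho) / (1 + tau * rho)).
  by rewrite rho_le ib_ge0 !lexx normE//; split=> // x; exact: iterE.
Qed.

End Contraction.

Theorem proposition1 (R : realType) (H : finHilbertType R)
    (H_neq0 : exists u : H, u != 0)
    (alpha beta rho : R)
    (alpha_gt0 : 0 < alpha) (beta_gt0 : 0 < beta)
    (rho_ge0 : 0 <= rho) (rho_le : rho <= alpha^-1)
    (M : splitting_method) (tau : R)
    (tau_adm : admissible_step M alpha beta tau) :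
  (exists (f g : H -> R) (x y : H),
     [/\ quadratic f /\ smooth_strongly_convex rho alpha^-1 f,
         quadratic g /\ smooth_strongly_convex 0 beta^-1 g,
         x != y &
         `|iteration M tau f g x - iteration M tau f g y| =
           contraction_bound M alpha beta rho tau * `|x - y| ]) /\
  is_worst_case_factor H M alpha beta rho tau
    (contraction_bound M alpha beta rho tau).
Proof.
have tau0 := admissible_step_gt0 tau_adm.
have [a [b [c [/andP[rho_a a_le] /andP[b0 b_le] iterE cE]]]] :=
  bound_attained (H := H) alpha_gt0 beta_gt0 rho_ge0 rho_le tau_adm.
have a0 := le_trans rho_ge0 rho_a.
have [u u0] := H_neq0.
have f_class := isotropic_smooth_strongly_convex (H := H) a0 rho_a a_le.
have g_class := isotropic_smooth_strongly_convex (H := H) b0 b0 b_le.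
have attained : `|iteration M tau (isotropic a) (isotropic b) u
                  - iteration M tau (isotropic a) (isotropic b) 0|
    = contraction_bound M alpha beta rho tau * `|u - 0|.
  by rewrite !iterE scaler0 !subr0 normrZ cE.
split.
  exists (isotropic a), (isotropic b), u, 0.
  by split=> //; split=> //; exact: quadratic_isotropic.
split; first split.
- exact: contraction_bound_ge0 (ltW tau0).
- by move=> f g f_mL g_mL x y; exact: iteration_contraction.
- move=> r [_ /(_ _ _ f_class g_class u 0)].
  by rewrite attained ler_pM2r// normr_gt0 subr0.
Qed.
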